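(* Assume $\operatorname{rk}L=2$, $\omega$ is non-degenerate, and let $V=(v_1,\dots,v_n)\in L^n$ be an exchange collection consisting of primitive vectors. For every $1\le i\le n$, $$\mathcal U(V)=\mu_{v_i}^*\bigl(\mathcal U(\mu_iV)\bigr)$$ as subalgebras of $\mathbb K_L$. Consequently, for any sequence of directions $i_1,\dots,i_s$, setting $V^{(0)}=V$ and $V^{(t)}=\mu_{i_t}V^{(t-1)}$ (with $V^{(t-1)}=(v^{(t-1)}_1,\dots,v^{(t-1)}_n)$), one has $$\mathcal U(V)=\mu^*_{v^{(0)}_{i_1}}\mu^*_{v^{(1)}_{i_2}}\cdots\mu^*_{v^{(s-1)}_{i_s}}\bigl(\mathcal U(V^{(s)})\bigr).$$
   Context: Let $L\cong\mathbb Z^r$ be a lattice, $L^*=\mathrm{Hom}(L,\mathbb Z)$, $(\cdot,\cdot):L^*\times L\to\mathbb Z$ the canonical pairing, and $\omega:L\times L\to\mathbb Z$ a skew-symmetric bilinear form. Let $\mathcal Q=\mathbb Q(e^{2\pi i\mathbb Q})$ be $\mathbb Q$ with all roots of unity adjoined, $\mathcal Q[L^*]$ the group algebra of $L^*$ (Laurent polynomials) with monomials $X^m$ ($m\in L^*$), and $\mathbb K_L$ its fraction field. For $v\in L$ let $\mu_v^*$ be the $\mathcal Q$-algebra automorphism of $\mathbb K_L$ given by $\mu_v^*(X^m)=X^m\,(1+X^{\omega(\cdot,v)})^{-(m,v)}$, where $\omega(\cdot,v)\in L^*$ is $w\mapsto\omega(w,v)$. (In rank 2, with basis $e_1,e_2$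 of $L$, dual basis $f_1,f_2$, $x_i=X^{f_i}$, $k=\omega(e_1,e_2)$: $\mu_{e_2}^*(x_1,x_2)=(x_1,\,x_2/(1+x_1^k))$ and $\mu_{e_1}^*(x_1,x_2)=(x_1/(1+x_2^{-k}),\,x_2)$.) An exchange collection is an $n$-tuple $V=(v_1,\dots,v_n)\in L^n$ (repetitions allowed), with multiplicity function $m_V(v)=\#\{i: v_i=v\}$. The upper bound of $V$ is the $\mathcal Q$-subalgebra $\mathcal U(V)=\mathcal U(L,\omega;V)=\mathcal Q[L^*]\cap\bigcap_{v\in L}(\mu_v^* )^{m_V(v)}\bigl(\mathcal Q[L^*]\bigr)\subset\mathbb K_L$. The mutation of $V$ in direction $j$ is $\mu_jV=(v_1',\dots,v_n')$ with $v_j'=-v_j$ and $v_i'=v_i+\max(0,\omega(v_j,v_i))\,v_j$ for $i\ne j$. A vector of $L$ is primitive if it is nonzero and not a multiple $kw$ with $k>1$, $w\in L$. *)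

(* Defs.v *)
From HB Require Import structures.
From mathcomp Require Import all_boot all_order all_algebra all_field.
Set Implicit Arguments. Unset Strict Implicit. Unset Printing Implicit Defensive.
Import Order.TTheory GRing.Theory Num.Theory.
Local Open Scope ring_scope.

(* The lattice L (rank 2) is identified with Z^2 = int * int via a basis
   e1,e2; L^* = Z^2 via the dual basis f1,f2, the pairing being the dot
   product.  A skew-symmetric form on Z^2 is omega(u,w) = k*det(u,w),
   with k = omega(e1,e2); it is non-degenerate iff k <> 0. *)
Definition vec := (int * int)%type.
Definition vadd (u w : vec) : vec := (u.1 + w.1, u.2 + w.2).
Definition vscale (c : int) (w : vec) : vec := (c * w.1, c * w.2).
Definition vneg (u : vec) : vec := (- u.1, - u.2).
Definition omega (k : int) (u w : vec) : int := k * (u.1 * w.2 - u.2 * w.1).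

Definition primitive (v : vec) : Prop :=
  v <> (0, 0) /\ forall (c : nat) (w : vec), (1 < c)%N -> v <> vscale c%:Z w.

Definition mutate (k : int) (V : seq vec) (j : nat) : seq vec :=
  let vj := nth (0, 0) V j in
  mkseq (fun i => let vi := nth (0, 0) V i in
           if i == j then vneg vj
           else vadd vi (vscale (Num.max 0 (omega k vj vi)) vj)) (size V).

(* Q(e^{2 pi i Q}) realised inside algC: elements of Q[zeta] for some root
   of unity zeta. *)
Definition inQab (z : algC) : Prop :=
  exists (n : nat) (zeta : algC) (p : {poly rat}),
    (0 < n)%N /\ zeta ^+ n = 1 /\ z = (map_poly ratr p).[zeta].

(* Polynomials in x1 (inner variable), x2 (outer variable) over algC and
   the ambient field of rational functions. *)
Definition Pol := {poly {poly algC}}.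
Definition KL := {fraction Pol}.

Definition x1 : KL := tofrac (('X : {poly algC})%:P).
Definition x2 : KL := tofrac ('X : Pol).
Definition cst (z : algC) : KL := tofrac (z%:P%:P).

Definition monX (m : vec) : KL := x1 ^ m.1 * x2 ^ m.2.

Definition laurent (f : KL) : Prop :=
  exists (p : Pol) (a b : nat),
    (forall i j, inQab ((p`_i)`_j)) /\ f = tofrac p * (x1 ^- a * x2 ^- b).

Definition ev (a b : KL) (p : Pol) : KL :=
  (map_poly (fun c : {poly algC} => (map_poly cst c).[a]) p).[b].

(* omega(., v) as an element of L^* : w |-> omega(w,v) *)
Definition omega_dual (k : int) (v : vec) : vec := (k * v.2, - (k * v.1)).

(* mu_v^* : X^m |-> X^m (1 + X^{omega(.,v)})^{-(m,v)} *)
Definition mu_x1 (k : int) (v : vec) : KL := x1 * (1 + monX (omega_dual k v)) ^ (- v.1).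
Definition mu_x2 (k : int) (v : vec) : KL := x2 * (1 + monX (omega_dual k v)) ^ (- v.2).

Definition mu (k : int) (v : vec) (f : KL) : KL :=
  let r := frac (repr f) in
  ev (mu_x1 k v) (mu_x2 k v) r.1 / ev (mu_x1 k v) (mu_x2 k v) r.2.

Definition upper (k : int) (V : seq vec) (f : KL) : Prop :=
  laurent f /\
  forall v : vec, exists g, laurent g /\ iter (count_mem v V) (mu k v) g = f.

Fixpoint mu_seq (k : int) (V : seq vec) (s : seq nat) (g : KL) : KL :=
  match s with
  | [::] => g
  | i :: s' => mu k (nth (0, 0) V i) (mu_seq k (mutate k V i) s' g)
  end.

(* Main.v *)
(** The group L^* grades Laurent polynomials by (., u), and mu_u multiplies a
    piece of degree d by h^(-d), where h = 1 + X^omega(., u) is fixed by mu_u.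
    As h is not a root of unity the pieces are independent, so f and
    mu_u^(-n) f are both Laurent exactly when h^(n|d|) divides the piece of
    degree d < 0.

    In direction v = v_i, this description shows that the conditions imposed
    on f by the vectors v and -v alone agree for V and mu_i V.  For u not
    parallel to v one compares the condition at u with the condition at its
    image in mu_i V, given that f and g = mu_v^(-1) f are both Laurent.  If
    omega(u, v) > 0 then u is unchanged.  The graded description shows that
    the condition passes between f and g up to powers of 1 + X^omega(., v);
    mu_u^(-n) sends this factor to q = 1 mod h, which is comaximal with the
    powers of h and can therefore be cancelled.  If omega(u, v) < 0 one
    applies this to -v: mu_{-v} mu_v is a monomial change of variables, and it
    conjugates mu_{u + omega(v, u) v} into mu_u. *)
Require Import Defs.
From HB Require Import structures.
From mathcomp Require Import all_boot all_order all_algebra all_field.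
From mathcomp Require Import zify ring.
Set Implicit Arguments. Unset Strict Implicit. Unset Printing Implicit Defensive.
Import Order.TTheory GRing.Theory Num.Theory.
Local Open Scope ring_scope.

Local Notation "x %:F" := (tofrac x).

(** * Evaluation of bivariate polynomials as a ring morphism *)

Lemma cst_is_zmod_morphism : zmod_morphism cst.
Proof. by move=> a b; rewrite /cst !rmorphB. Qed.
Lemma cst_is_monoid_morphism : monoid_morphism cst.
Proof. by split=> [|a b]; rewrite /cst ?rmorph1 ?rmorphM. Qed.
HB.instance Definition _ :=
  GRing.isZmodMorphism.Build algC KL cst cst_is_zmod_morphism.
HB.instance Definition _ :=
  GRing.isMonoidMorphism.Build algC KL cst cst_is_monoid_morphism.

Lemma ev_is_zmod_morphism a b : zmod_morphism (ev a b).
Proof.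
move=> p q; rewrite /ev -hornerN -hornerD; congr _.[b].
apply/polyP=> i; rewrite coefB !coef_map_id0 ?rmorph0 ?horner0 //.
by rewrite coefB rmorphB hornerD hornerN.
Qed.

Lemma ev_is_monoid_morphism a b : monoid_morphism (ev a b).
Proof.
pose f := horner_eval a \o map_poly cst.
have evE p : ev a b p = (map_poly f p).[b] by [].
by split=> [|p q]; rewrite !evE ?rmorph1 ?hornerC // rmorphM hornerM.
Qed.

HB.instance Definition _ a b :=
  GRing.isZmodMorphism.Build Pol KL (ev a b) (ev_is_zmod_morphism a b).
HB.instance Definition _ a b :=
  GRing.isMonoidMorphism.Build Pol KL (ev a b) (ev_is_monoid_morphism a b).

Lemma ev_const a b c : ev a b c%:P%:P = cst c.
Proof.
pose f := horner_eval a \o map_poly cst.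
rewrite -[LHS]/((map_poly f _).[b]) map_polyC hornerC /f /= /horner_eval.
by rewrite map_polyC hornerC.
Qed.

Lemma ev_X1 a b : ev a b 'X%:P = a.
Proof.
pose f := horner_eval a \o map_poly cst.
rewrite -[LHS]/((map_poly f _).[b]) map_polyC hornerC /f /= /horner_eval.
by rewrite map_polyX hornerX.
Qed.

Lemma ev_X2 a b : ev a b 'X = b.
Proof.
pose f := horner_eval a \o map_poly cst.
by rewrite -[LHS]/((map_poly f 'X).[b]) map_polyX hornerX.
Qed.

(** Equalities between morphisms on [Pol] need checking only on constants and the two variables;
    later sections assume this principle in place of the concrete ring. *)
Lemma Pol_ind (P : Pol -> Prop) :
  (forall c, P c%:P%:P) -> P 'X%:P -> P 'X ->
  (forall p q, P p -> P q -> P (p + q)) -> (forall p q, P p -> P q -> P (p * q)) ->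
  forall p, P p.
Proof.
move=> Pc P1 P2 PD PM; elim/poly_ind => [|p c IHp]; first exact: (Pc 0).
apply: (PD); first exact: (PM).
elim/poly_ind: c => [|q d IHq]; first exact: (Pc 0).
by rewrite polyCD polyCM; apply: PD => //; apply: PM.
Qed.

(** * Extension of a ring morphism to the fraction field *)

Section FractionMorphism.
Variables (R : idomainType) (K : fieldType) (phi : {rmorphism R -> K}).
Implicit Types (p q d : R) (f g : {fraction R}) (x y : K).

Definition numer f : R := (frac (repr f)).1.
Definition denom f : R := (frac (repr f)).2.

Lemma denom_neq0 f : denom f != 0.
Proof. exact: denom_ratioP. Qed.

Lemma fracE f : f = (numer f)%:F / (denom f)%:F.
Proof.
apply: (@mulIf _ (denom f)%:F); rewrite ?tofrac_eq0 ?denom_neq0 //.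
rewrite divfK ?tofrac_eq0 ?denom_neq0 // /numer /denom.
have hd := denom_neq0 f; rewrite -{1}[f]reprK; unlock FracField.tofrac.
rewrite -[_ * _]/(FracField.mul _ _) -FracField.pi_mul /=.
apply/eqP; rewrite piE /FracField.equivf /=.
rewrite /FracField.mulf !numden_Ratio ?oner_neq0 ?mulr1 //.
by rewrite mulrC.
Qed.

(* The graph of the partial extension of [phi] to the fractions having a
   representative whose denominator is not killed. *)
Definition frac_graph f x :=
  exists p d, [/\ phi d != 0, f = p%:F / d%:F & x = phi p / phi d].

Lemma morph_neq0 p : phi p != 0 -> p != 0.
Proof. by apply: contraNneq => ->; rewrite rmorph0. Qed.

Lemma frac_graph_tofrac p : frac_graph p%:F (phi p).
Proof. by exists p, 1; rewrite !rmorph1 !divr1 oner_neq0. Qed.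

Lemma frac_graph_fun f x y : frac_graph f x -> frac_graph f y -> x = y.
Proof.
move=> [p [d [d0 -> ->]]] [p' [d' [d0' /eqP E ->]]].
move: E; rewrite eqr_div ?tofrac_eq0 ?morph_neq0 // -!tofracM tofrac_eq => /eqP E.
by apply/eqP; rewrite (eqr_div _ _ d0 d0') -!(rmorphM phi) E.
Qed.

Lemma frac_graphD f g x y :
  frac_graph f x -> frac_graph g y -> frac_graph (f + g) (x + y).
Proof.
move=> [p [d [d0 -> ->]]] [q [e [e0 -> ->]]]; exists (p * e + q * d), (d * e).
by rewrite !rmorphD !rmorphM mulf_neq0 ?addf_div ?tofrac_eq0 ?morph_neq0.
Qed.

Lemma frac_graphM f g x y :
  frac_graph f x -> frac_graph g y -> frac_graph (f * g) (x * y).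
Proof.
move=> [p [d [d0 -> ->]]] [q [e [e0 -> ->]]]; exists (p * q), (d * e).
by rewrite !rmorphM mulf_neq0 ?mulf_div.
Qed.

Lemma frac_graphV f x : x != 0 -> frac_graph f x -> frac_graph f^-1 x^-1.
Proof.
move=> x0 [p [d [d0 -> E]]]; exists d, p; rewrite E !invf_div; split=> //.
by apply: contraNneq x0 => E'; rewrite E E' mul0r.
Qed.

Lemma frac_graph1 : frac_graph 1 1.
Proof. by have := frac_graph_tofrac 1; rewrite !rmorph1. Qed.

Lemma frac_graphX f x (n : int) : x != 0 -> frac_graph f x -> frac_graph (f ^ n) (x ^ n).
Proof.
move=> x0 fx.
have natX m : frac_graph (f ^+ m) (x ^+ m).
  elim: m => [|m IH]; first exact: frac_graph1.
  by rewrite !exprS; apply: frac_graphM.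
case: n => m; rewrite ?NegzE -?exprnN -?exprnP //.
by apply: frac_graphV; rewrite ?expf_neq0.
Qed.

(** The formula of [mu] for a general [phi]. It uses a chosen representative; injectivity of [phi]
    places its value on the graph, which is functional, and so removes the dependence on that
    choice. *)
Definition frac_ext f : K := phi (numer f) / phi (denom f).

Hypothesis phi_neq0 : forall p, p != 0 -> phi p != 0.

Lemma frac_ext_graph f : frac_graph f (frac_ext f).
Proof. by exists (numer f), (denom f); rewrite -fracE phi_neq0 ?denom_neq0. Qed.

Lemma frac_ext_unique f x : frac_graph f x -> frac_ext f = x.
Proof. exact/frac_graph_fun/frac_ext_graph. Qed.

Lemma frac_ext_is_zmod_morphism : zmod_morphism frac_ext.
Proof.
move=> f g; apply: frac_ext_unique; apply: frac_graphD; first exact: frac_ext_graph.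
rewrite -mulN1r -[- frac_ext _]mulN1r; apply: frac_graphM; last exact: frac_ext_graph.
by have := frac_graph_tofrac (-1); rewrite !rmorphN1.
Qed.

Lemma frac_ext_is_monoid_morphism : monoid_morphism frac_ext.
Proof.
split=> [|f g]; apply: frac_ext_unique; first exact: frac_graph1.
by apply: frac_graphM; apply: frac_ext_graph.
Qed.
End FractionMorphism.

(** * The form, primitive vectors and the piecewise linear map of a mutation *)

Definition vdot (m v : vec) : int := m.1 * v.1 + m.2 * v.2.

Lemma vdot_omega_dual k u v : vdot (omega_dual k u) v = omega k v u.
Proof. by rewrite /vdot /omega_dual /omega /=; ring. Qed.

Lemma omegavv k v : omega k v v = 0.
Proof. by rewrite /omega; ring. Qed.

Lemma omegaC k u v : omega k v u = - omega k u v.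
Proof. by rewrite /omega; ring. Qed.

Lemma omega_dual_neq0 k v : k != 0 -> v <> (0, 0) -> omega_dual k v <> (0, 0).
Proof.
case: v => a b k0 v0; rewrite /omega_dual /= => -[/eqP + /eqP]; rewrite oppr_eq0 !mulf_eq0.
by rewrite (negPf k0) /= => /eqP b0 /eqP a0; apply: v0; rewrite a0 b0.
Qed.

Lemma vec_eqP (u w : vec) : u.1 = w.1 -> u.2 = w.2 -> u = w.
Proof. by case: u w => [a b] [c d] /= -> ->. Qed.

Lemma vnegK : involutive vneg.
Proof. by case=> a b; rewrite /vneg /= !opprK. Qed.

Definition pltrans k (v u : vec) : vec :=
  vadd u (vscale (Num.max 0 (omega k v u)) v).

Lemma omega_addscale k v u c : omega k v (vadd u (vscale c v)) = omega k v u.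
Proof. by rewrite /omega /vadd /vscale /=; ring. Qed.

Definition pltrans_inv k (v u : vec) : vec :=
  vadd u (vscale (- Num.max 0 (omega k v u)) v).

(** Adding a multiple of [v] does not change [omega k v], so the same maximum is first added and
    then subtracted. *)
Lemma pltransK k v : cancel (pltrans k v) (pltrans_inv k v).
Proof.
move=> u; rewrite /pltrans_inv omega_addscale /pltrans.
by apply: vec_eqP; rewrite /vadd /vscale /=; ring.
Qed.

Lemma pltrans_invK k v : cancel (pltrans_inv k v) (pltrans k v).
Proof.
move=> u; rewrite /pltrans omega_addscale /pltrans_inv.
by apply: vec_eqP; rewrite /vadd /vscale /=; ring.
Qed.

Lemma pltrans_inj k v : injective (pltrans k v).
Proof. exact: can_inj (pltransK k v). Qed.

Lemma pltrans_fix k v u : omega k v u = 0 -> pltrans k v u = u.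
Proof.
by move=> E; rewrite /pltrans E maxxx; apply: vec_eqP; rewrite /vadd /vscale /=; ring.
Qed.

Lemma pltrans_id k v : pltrans k v v = v.
Proof. by rewrite pltrans_fix ?omegavv. Qed.

Lemma pltrans_neg k v : pltrans k v (vneg v) = vneg v.
Proof. by rewrite pltrans_fix // /omega /vneg /=; ring. Qed.

Lemma primitive_neg v : primitive v -> primitive (vneg v).
Proof.
move=> [v0 vP]; split=> [E|c w c1 E].
  by apply: v0; rewrite -[v]vnegK E /vneg /= oppr0.
by apply: (vP c (vneg w) c1); rewrite -[v]vnegK E /vneg /vscale /= !mulrN.
Qed.

Lemma primitive_pltrans k v u : primitive u -> primitive (pltrans k v u).
Proof.
move=> [u0 uP]; split=> [E|c w c1 E].
  have o0 : omega k v u = 0.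
    rewrite -[LHS](omega_addscale k v u (Num.max 0 (omega k v u))).
    by rewrite -/(pltrans k v u) E /omega /=; ring.
  by apply: u0; rewrite -E pltrans_fix.
(* The inverse map is homogeneous for positive scalars, so a factor [c] of the image is already a
   factor of [u]. *)
apply: (uP c (pltrans_inv k v w) c1); rewrite -[LHS](pltransK k v) E /pltrans_inv.
have -> : omega k v (vscale c w) = c%:Z * omega k v w.
  by rewrite /omega /vscale /=; ring.
rewrite -{1}(mulr0 c%:Z) -maxr_pMr //.
by apply: vec_eqP; rewrite /vadd /vscale /=; ring.
Qed.

Lemma primitive_bezout v : primitive v -> exists a b : int, a * v.1 + b * v.2 = 1.
Proof.
case: v => x y [v0 vP]; have [a [b E]] := Bezoutz x y; exists a, b; rewrite /= E.
have [g_lt1|g_gt1|g_eq1] := ltngtP (gcdn `|x| `|y|) 1%N.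
- have : gcdz x y == 0 by rewrite /gcdz; case: gcdn g_lt1.
  by rewrite gcdz_eq0 => /andP[/eqP x0 /eqP y0]; case: v0; rewrite x0 y0.
- case: (vP _ ((x %/ gcdz x y)%Z, (y %/ gcdz x y)%Z) g_gt1).
  by apply: vec_eqP; apply/esym; rewrite [LHS]mulrC; apply: divzK;
    [exact: dvdz_gcdl | exact: dvdz_gcdr].
- by rewrite /gcdz g_eq1.
Qed.

(** A Bezout relation for [v] produces an integer [l] with [u = l v], and primitivity of [u] forces
    [l] to be 1 or -1. *)
Lemma primitive_parallel k u v : k != 0 -> primitive u -> primitive v ->
  omega k v u = 0 -> u = v \/ u = vneg v.
Proof.
move=> k0 [u0 uP] vP /eqP; rewrite /omega mulf_eq0 (negPf k0) /= => /eqP o0.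
have [a [b ab]] := primitive_bezout vP.
pose l := a * u.1 + b * u.2.
have uE : u = vscale l v.
  have uv : v.1 * u.2 = v.2 * u.1 by apply/eqP; rewrite -subr_eq0 o0.
  apply: vec_eqP; rewrite /vscale /l /=.
    rewrite -[LHS]mul1r -ab mulrDl [RHS]mulrDl -[b * v.2 * _]mulrA -uv; ring.
  rewrite -[LHS]mul1r -ab mulrDl [RHS]mulrDl -[a * v.1 * _]mulrA uv; ring.
have [l_lt1|l_gt1|l_eq1] := ltngtP `|l|%N 1%N.
- have l0 : l = 0 by apply/eqP; rewrite -absz_eq0 -leqn0 -ltnS.
  by case: u0; rewrite uE l0 /vscale !mul0r.
- case: (uP _ (vscale (sgz l) v) l_gt1); rewrite [LHS]uE.
  by apply: vec_eqP; rewrite /= mulrA [_%:Z * _]mulrC -intEsg.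
- have [l1|l1] : l = 1 \/ l = -1 by lia.
    by left; rewrite uE l1; apply: vec_eqP; rewrite /= mul1r.
  by right; rewrite uE l1; apply: vec_eqP; rewrite /= mulN1r.
Qed.

Lemma primitive_neq_neg v : primitive v -> v != vneg v.
Proof.
by case: v => x y [v0 _]; apply/eqP => -[e1 e2]; apply: v0; congr (_, _); lia.
Qed.

(** * Multiplicities under mutation *)

Section Mutation.
Variables (k : int) (V : seq vec) (i : nat).
Hypothesis iV : (i < size V)%N.
Local Notation v := (nth (0, 0) V i).
Local Notation t := (pltrans k v).

Lemma mutate_split :
  mutate k V i = map t (take i V) ++ vneg v :: map t (drop i.+1 V).
Proof.
apply: (@eq_from_nth _ (0, 0)).
  by rewrite size_mkseq size_cat /= !size_map size_take size_drop iV addnS -addSn subnKC.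
move=> j; rewrite size_mkseq => jV; rewrite nth_mkseq // nth_cat size_map size_takel ?(ltnW iV) //.
have [ji|ij|->] := ltngtP j i.
- by rewrite (nth_map (0, 0)) ?nth_take // size_takel // ltnW.
- rewrite -(subnSK ij) /= (nth_map (0, 0)) ?nth_drop ?subnKC //.
  by rewrite size_drop ltn_sub2r // (leq_ltn_trans ij jV).
- by rewrite subnn.
Qed.

Lemma size_mutate : size (mutate k V i) = size V.
Proof. by rewrite size_mkseq. Qed.

Lemma collection_split : V = take i V ++ v :: drop i.+1 V.
Proof. by rewrite -drop_nth // cat_take_drop. Qed.

Lemma count_pltrans u s : count_mem (t u) (map t s) = count_mem u s.
Proof. by rewrite count_map; apply: eq_count => w /=; rewrite (inj_eq (@pltrans_inj k v)). Qed.

Lemma count_mutate u : u != v -> u != vneg v ->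
  count_mem (t u) (mutate k V i) = count_mem u V.
Proof.
move=> uv uv'; rewrite mutate_split [in RHS]collection_split !count_cat /= !count_pltrans.
rewrite eq_sym -{1}(pltrans_neg k v) (inj_eq (@pltrans_inj k v)) (negPf uv').
by rewrite eq_sym (negPf uv).
Qed.

Lemma count_pltrans_fix u s : t u = u -> count_mem u (map t s) = count_mem u s.
Proof. by move=> {1}<-; apply: count_pltrans. Qed.

(** All other copies of [v] are fixed by [t], so only the entry at position [i] changes; it becomes
    [vneg v], which differs from [v]. *)
Lemma count_mutate_dir : primitive v -> count_mem v V = (count_mem v (mutate k V i)).+1.
Proof.
move=> /primitive_neq_neg vP; have tv := pltrans_id k v.
rewrite mutate_split count_cat (congr1 (count_mem v) collection_split) count_cat /=.
rewrite !count_pltrans_fix //.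
by rewrite eqxx eq_sym (negPf vP) add0n addnS.
Qed.

Lemma count_mutate_neg : primitive v ->
  count_mem (vneg v) (mutate k V i) = (count_mem (vneg v) V).+1.
Proof.
move=> /primitive_neq_neg vP; have tv := pltrans_neg k v.
rewrite mutate_split count_cat (congr1 (count_mem (vneg v)) collection_split) count_cat /=.
rewrite !count_pltrans_fix //.
by rewrite eqxx (negPf vP) add0n addnS.
Qed.

Lemma primitive_mutate : (forall u, u \in V -> primitive u) ->
  forall u, u \in mutate k V i -> primitive u.
Proof.
move=> VP u; rewrite mutate_split mem_cat inE => /or3P[/mapP[w wV ->]|/eqP ->|/mapP[w wV ->]].
- exact/primitive_pltrans/VP/(mem_take wV).
- exact/primitive_neg/VP/mem_nth.
- exact/primitive_pltrans/VP/(mem_drop wV).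
Qed.
End Mutation.

(** * Laurent monomials and the factor $1+X^{\omega(\cdot,v)}$ *)

Lemma int_nat_sub (z : int) : exists i j : nat, z = i%:Z - j%:Z.
Proof.
by case: z => i; [exists i, 0%N | exists 0%N, i.+1]; rewrite ?NegzE; lia.
Qed.

Section Monomials.
Variables (K : fieldType) (y1 y2 : K).
Hypotheses (y1_neq0 : y1 != 0) (y2_neq0 : y2 != 0).

Definition lmon (m : vec) : K := y1 ^ m.1 * y2 ^ m.2.

Lemma lmon0 : lmon (0, 0) = 1.
Proof. by rewrite /lmon !expr0z mulr1. Qed.

Lemma lmonD m n : lmon (vadd m n) = lmon m * lmon n.
Proof. by rewrite /lmon !expfzDr // mulrACA. Qed.

Lemma lmon_exp m (c : int) : lmon m ^ c = lmon (vscale c m).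
Proof. by rewrite /lmon /vscale /= expfzMl !exprz_exp !(mulrC c). Qed.

(** Clearing denominators reduces relations between Laurent monomials to relations between ordinary
    monomials. *)
Lemma lmon_sub (i i' j j' : nat) c : lmon (i%:Z - i'%:Z, j%:Z - j'%:Z) = c ->
  y1 ^+ i * y2 ^+ j = c * (y1 ^+ i' * y2 ^+ j').
Proof.
move=> <-; rewrite /lmon /= !expfzDr // -!exprnN -!exprnP.
by field; rewrite !expf_neq0.
Qed.
End Monomials.

Definition hfac (K : fieldType) (mon : vec -> K) k v : K := 1 + mon (omega_dual k v).

Section Hfac.
Variables (K : fieldType) (mon : vec -> K) (C : {rmorphism algC -> K}).
Hypothesis mon0 : mon (0, 0) = 1.
Hypothesis mon_const : forall m c, mon m = C c -> m = (0, 0).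

Lemma hfac_neq0 k v : hfac mon k v != 0.
Proof.
apply/eqP => /eqP; rewrite /hfac addrC addr_eq0 => /eqP E.
have /mon_const w0 : mon (omega_dual k v) = C (-1) by rewrite rmorphN1.
move: E; rewrite w0 mon0 => /eqP; rewrite -addr_eq0 -(rmorph1 C) -rmorphD.
by rewrite fmorph_eq0 (_ : 1 + 1 = 2%:R) // pnatr_eq0.
Qed.

(** Every root of unity of [K] is the image of one in [algC]. If the factor were such a root, a
    nontrivial monomial would be constant. *)
Lemma hfac_not_unity k v (n : int) :
  k != 0 -> v <> (0, 0) -> n != 0 -> hfac mon k v ^ n != 1.
Proof.
move=> k0 v0.
have natX m : (0 < m)%N -> hfac mon k v ^+ m != 1.
  move=> m0; apply/eqP => E; have [z z_prim] := C_prim_root_exists m0.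
  have z_prim' : m.-primitive_root (C z) by rewrite fmorph_primitive_root.
  have [i] := prim_rootP z_prim' E; rewrite /hfac -rmorphXn => Ei.
  apply: (omega_dual_neq0 k0 v0); apply: (@mon_const _ (z ^+ i - 1)).
  by rewrite rmorphB rmorph1 /= -Ei addrC addKr.
case: n => m m0; first by apply: natX; case: m m0.
by rewrite NegzE -exprnN invr_eq1 natX.
Qed.
End Hfac.

(** * Integer powers of $\mu_v^*$ as field morphisms *)

(* [R] plays the role of algC[x1, x2]; in the concrete field [KL] unification and
   closing tactics compute with polynomials over [algC] and do not terminate. *)
Section Twist.
Variables (R : idomainType) (C : {rmorphism algC -> R}) (X1 X2 : R).
Local Notation K := {fraction R}.
Variable ev : K -> K -> {rmorphism R -> K}.
Hypothesis ev_const : forall a b c, ev a b (C c) = (C c)%:F.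
Hypothesis ev_X1 : forall a b, ev a b X1 = a.
Hypothesis ev_X2 : forall a b, ev a b X2 = b.
Hypothesis gen_ind : forall P : R -> Prop,
  (forall c, P (C c)) -> P X1 -> P X2 ->
  (forall p q, P p -> P q -> P (p + q)) -> (forall p q, P p -> P q -> P (p * q)) ->
  forall p, P p.
Hypotheses (X1_neq0 : X1 != 0) (X2_neq0 : X2 != 0).
Hypothesis indep : forall c i j i' j',
  X1 ^+ i * X2 ^+ j = C c * (X1 ^+ i' * X2 ^+ j') -> i = i' /\ j = j'.

Lemma ev_graph_const a b c : frac_graph (ev a b) (C c)%:F (C c)%:F.
Proof. by have := frac_graph_tofrac (ev a b) (C c); rewrite ev_const. Qed.
Lemma ev_graph_X1 a b : frac_graph (ev a b) X1%:F a.
Proof. by have := frac_graph_tofrac (ev a b) X1; rewrite ev_X1. Qed.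
Lemma ev_graph_X2 a b : frac_graph (ev a b) X2%:F b.
Proof. by have := frac_graph_tofrac (ev a b) X2; rewrite ev_X2. Qed.

(* A left inverse defined on the image is enough for injectivity. *)
Lemma ev_inj a b a' b' :
  frac_graph (ev a' b') a X1%:F -> frac_graph (ev a' b') b X2%:F ->
  forall p, p != 0 -> ev a b p != 0.
Proof.
move=> ha hb p p0; apply/eqP => E.
suff evK q : frac_graph (ev a' b') (ev a b q) q%:F.
  have z0 := ev_graph_const a' b' 0; rewrite !rmorph0 in z0.
  by have := evK p; rewrite E => /frac_graph_fun - /(_ _ z0) /eqP; rewrite tofrac_eq0 (negPf p0).
elim/gen_ind: q => [c|||q r Hq Hr|q r Hq Hr].
- by rewrite ev_const; apply: ev_graph_const.
- by rewrite ev_X1.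
- by rewrite ev_X2.
- by rewrite !rmorphD; apply: frac_graphD.
- by rewrite !rmorphM; apply: frac_graphM.
Qed.

Lemma frac_morphism_ext (f g : {rmorphism K -> K}) :
  (forall c, f (C c)%:F = g (C c)%:F) -> f X1%:F = g X1%:F -> f X2%:F = g X2%:F ->
  f =1 g.
Proof.
move=> fc f1 f2; have fp p : f p%:F = g p%:F.
  elim/gen_ind: p => // p q; first by rewrite !rmorphD => -> ->.
  by rewrite !rmorphM => -> ->.
by move=> h; rewrite (fracE h) !fmorph_div !fp.
Qed.

Local Notation y1 := (X1%:F : K).
Local Notation y2 := (X2%:F : K).

Lemma tofracX1_neq0 : y1 != 0. Proof. by rewrite tofrac_eq0. Qed.
Lemma tofracX2_neq0 : y2 != 0. Proof. by rewrite tofrac_eq0. Qed.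
Let y12_neq0 := (tofracX1_neq0, tofracX2_neq0).

Lemma lmon_const m c : lmon y1 y2 m = (C c)%:F -> m = (0, 0).
Proof.
case: m => a b; have [i [i' ->]] := int_nat_sub a; have [j [j' ->]] := int_nat_sub b.
move=> /(lmon_sub tofracX1_neq0 tofracX2_neq0).
rewrite -!tofracXn -!tofracM => /eqP; rewrite tofrac_eq => /eqP /indep [-> ->].
by rewrite !subrr.
Qed.

Variables (k : int) (v : vec).
Local Notation h := (hfac (lmon y1 y2) k v).
Local Notation ev_tw c := (ev (y1 * h ^ (- (c * v.1))) (y2 * h ^ (- (c * v.2)))).

Let h_neq0 : h != 0.
Proof. exact: (@hfac_neq0 _ _ (@tofrac R \o C) (lmon0 _ _) lmon_const). Qed.

Lemma ev_graph_mon c m :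
  frac_graph (ev_tw c) (lmon y1 y2 m) (lmon y1 y2 m * h ^ (- (c * vdot m v))).
Proof.
have -> : lmon y1 y2 m * h ^ (- (c * vdot m v)) =
    (y1 * h ^ (- (c * v.1))) ^ m.1 * (y2 * h ^ (- (c * v.2))) ^ m.2.
  rewrite !expfzMl mulrACA !exprz_exp -expfzDr //.
  by congr (_ * _ ^ _); rewrite /vdot; ring.
by apply: frac_graphM; apply: frac_graphX; rewrite ?mulf_neq0 ?expfz_neq0 ?y12_neq0 //;
  [apply: ev_graph_X1 | apply: ev_graph_X2].
Qed.

Lemma ev_graph_hfac c : frac_graph (ev_tw c) h h.
Proof.
apply: frac_graphD; first exact: frac_graph1.
have := ev_graph_mon c (omega_dual k v).
by rewrite vdot_omega_dual omegavv mulr0 oppr0 expr0z mulr1.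
Qed.

(** The left inverse required by [ev_inj] is the substitution with parameter [- c]: as [h] is fixed,
    the two powers of [h] cancel. *)
Lemma ev_twist_neq0 c p : p != 0 -> ev_tw c p != 0.
Proof.
apply: (@ev_inj _ _ (y1 * h ^ (- (- c * v.1))) (y2 * h ^ (- (- c * v.2)))).
- have E : y1 = (y1 * h ^ (- (- c * v.1))) * h ^ (- (c * v.1)).
    by rewrite -mulrA -expfzDr // mulNr opprK subrr expr0z mulr1.
  rewrite [X in frac_graph _ _ X]E; apply: frac_graphM; first exact: ev_graph_X1.
  by apply: frac_graphX => //; apply: ev_graph_hfac.
- have E : y2 = (y2 * h ^ (- (- c * v.2))) * h ^ (- (c * v.2)).
    by rewrite -mulrA -expfzDr // mulNr opprK subrr expr0z mulr1.
  rewrite [X in frac_graph _ _ X]E; apply: frac_graphM; first exact: ev_graph_X2.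
  by apply: frac_graphX => //; apply: ev_graph_hfac.
Qed.

(** The integer parameter provides all powers of $\mu_v^*$ at once, inverses included; [c = 1] is
    $\mu_v^*$ itself. *)
Definition twist (c : int) : K -> K := frac_ext (ev_tw c).

Lemma twist_is_zmod_morphism c : zmod_morphism (twist c).
Proof. exact: frac_ext_is_zmod_morphism (@ev_twist_neq0 c). Qed.

Lemma twist_is_monoid_morphism c : monoid_morphism (twist c).
Proof. exact: frac_ext_is_monoid_morphism (@ev_twist_neq0 c). Qed.

Lemma twist_const c a : twist c (C a)%:F = (C a)%:F.
Proof. by apply: (frac_ext_unique (@ev_twist_neq0 c)); apply: ev_graph_const. Qed.

Lemma twist_mon c m : twist c (lmon y1 y2 m) = lmon y1 y2 m * h ^ (- (c * vdot m v)).
Proof. by apply: (frac_ext_unique (@ev_twist_neq0 c)); apply: ev_graph_mon. Qed.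
End Twist.

(** * The cyclotomic coefficients form a ring *)

Lemma inQab_root n (z : algC) p : (0 < n)%N -> n.-primitive_root z ->
  inQab (map_poly ratr p).[z].
Proof. by move=> n0 zP; exists n, z, p; rewrite prim_expr_order. Qed.

(** Both roots of unity are powers of one primitive root of order [n * m], so closure under sums and
    products becomes closure for rational polynomials in that root. *)
Lemma inQabP x y : inQab x -> inQab y -> exists (n : nat) (z : algC) (p q : {poly rat}),
  [/\ (0 < n)%N, n.-primitive_root z, x = (map_poly ratr p).[z] & y = (map_poly ratr q).[z]].
Proof.
move=> [n [z [p [n0 [zn ->]]]]] [m [w [q [m0 [wm ->]]]]].
have nm0 : (0 < n * m)%N by rewrite muln_gt0 n0.
have [t tP] := C_prim_root_exists nm0.
have [i ->] : {i : 'I_(n * m) | z = t ^+ i}.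
  by apply: (prim_rootP tP); rewrite exprM zn expr1n.
have [j ->] : {i : 'I_(n * m) | w = t ^+ i}.
  by apply: (prim_rootP tP); rewrite mulnC exprM wm expr1n.
exists (n * m)%N, t, (p \Po 'X^i), (q \Po 'X^j).
by rewrite !map_comp_poly !map_polyXn !horner_comp !hornerXn.
Qed.

Lemma inQabD x y : inQab x -> inQab y -> inQab (x + y).
Proof.
move=> hx hy; have [n [z [p [q [n0 zP -> ->]]]]] := inQabP hx hy.
by rewrite -hornerD -rmorphD; apply: inQab_root n0 zP.
Qed.

Lemma inQabM x y : inQab x -> inQab y -> inQab (x * y).
Proof.
move=> hx hy; have [n [z [p [q [n0 zP -> ->]]]]] := inQabP hx hy.
by rewrite -hornerM -rmorphM; apply: inQab_root n0 zP.
Qed.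

Lemma inQab_rat r : inQab (ratr r).
Proof. by exists 1%N, 1, r%:P; rewrite expr1n map_polyC hornerC. Qed.

Lemma inQab0 : inQab 0.
Proof. by have := inQab_rat 0; rewrite rmorph0. Qed.

Lemma inQab1 : inQab 1.
Proof. by have := inQab_rat 1; rewrite rmorph1. Qed.

Lemma inQabN1 : inQab (-1).
Proof. by have := inQab_rat (-1); rewrite rmorphN1. Qed.

(** * Laurent polynomials as spans of monomials, and powers of $\mu_v^*$ on them *)

Section LaurentSpan.
Variables (K : fieldType) (mon : vec -> K) (C : {rmorphism algC -> K}).
Hypothesis mon0 : mon (0, 0) = 1.
Hypothesis monD : forall m n, mon (vadd m n) = mon m * mon n.
Hypothesis mon_exp : forall m (c : int), mon m ^ c = mon (vscale c m).

(** The predicate on exponents serves two purposes: the trivial one gives all Laurent polynomials, a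
    degree condition gives a graded piece. *)
Inductive lspan (P : vec -> Prop) : K -> Prop :=
| lspan0 : lspan P 0
| lspan_add c m f : inQab c -> P m -> lspan P f -> lspan P (C c * mon m + f).

Lemma lspanD P f g : lspan P f -> lspan P g -> lspan P (f + g).
Proof.
move=> hf hg; elim: hf => [|c m f' hc hm _ IH]; first by rewrite add0r.
by rewrite -addrA; apply: lspan_add.
Qed.

Lemma lspan_mon P c m : inQab c -> P m -> lspan P (C c * mon m).
Proof. by move=> hc hm; rewrite -[X in lspan _ X]addr0; apply: lspan_add => //; apply: lspan0. Qed.

Lemma lspan_sub (P P' : vec -> Prop) f : (forall m, P m -> P' m) -> lspan P f -> lspan P' f.
Proof.
move=> PP'; elim=> [|c m f' hc /PP' hm _ IH]; first exact: lspan0.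
exact: lspan_add.
Qed.

Local Notation L := (lspan (fun=> True)).

Lemma laurent_const c : inQab c -> L (C c).
Proof. by move=> hc; rewrite -[C c]mulr1 -mon0; apply: lspan_mon. Qed.

Lemma laurent_mon m : L (mon m).
Proof. by rewrite -[mon m]mul1r -(rmorph1 C); apply: lspan_mon => //; apply: inQab1. Qed.

Lemma laurentM f g : L f -> L g -> L (f * g).
Proof.
move=> hf hg; elim: hf => [|c m f' hc _ _ IH]; first by rewrite mul0r; apply: lspan0.
rewrite mulrDl; apply: lspanD => {IH} //.
elim: hg => [|d n g' hd _ _ IH]; first by rewrite mulr0; apply: lspan0.
rewrite mulrDr mulrACA -rmorphM -monD //.
by apply: lspanD => //; apply: lspan_mon => //; apply: inQabM.
Qed.

Lemma laurent1 : L 1.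
Proof. by rewrite -(rmorph1 C); apply: laurent_const; apply: inQab1. Qed.

Lemma laurentN f : L f -> L (- f).
Proof.
move=> hf; rewrite -mulN1r -(rmorphN1 C); apply: laurentM => //.
by apply: laurent_const; apply: inQabN1.
Qed.

Lemma laurentX f (n : nat) : L f -> L (f ^+ n).
Proof.
move=> hf; elim: n => [|n IH]; first exact: laurent1.
by rewrite exprS; apply: laurentM.
Qed.

Lemma laurentXz f (n : int) : 0 <= n -> L f -> L (f ^ n).
Proof. by case: n => // n _; apply: laurentX. Qed.

Lemma laurent_hfac k v : L (hfac mon k v).
Proof. by apply: lspanD; [apply: laurent1 | apply: laurent_mon]. Qed.

Hypothesis mon_const : forall m c, mon m = C c -> m = (0, 0).
Variables (k : int) (mp : vec -> int -> {rmorphism K -> K}).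
Hypothesis mp_const : forall v c a, mp v c (C a) = C a.
Hypothesis mp_mon : forall v c m, mp v c (mon m) = mon m * hfac mon k v ^ (- (c * vdot m v)).
Hypothesis morph_ext_mon : forall f g : {rmorphism K -> K},
  (forall c, f (C c) = g (C c)) -> (forall m, f (mon m) = g (mon m)) -> f =1 g.
Local Notation h := (hfac mon k).
Let h_neq0 v : h v != 0. Proof. exact: hfac_neq0 mon0 mon_const k v. Qed.

Lemma hfac_neg v : h v = mon (omega_dual k v) * h (vneg v).
Proof.
rewrite /hfac mulrDr mulr1 -monD /vadd /omega_dual /vneg /=.
by rewrite !mulrN !subrr mon0 addrC.
Qed.

Lemma mp_hfac v c u : mp v c (h u) = 1 + mon (omega_dual k u) * h v ^ (- (c * omega k v u)).
Proof. by rewrite rmorphD rmorph1 mp_mon vdot_omega_dual. Qed.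

Lemma mp_hfac_id v c : mp v c (h v) = h v.
Proof. by rewrite mp_hfac omegavv mulr0 oppr0 expr0z mulr1. Qed.

Lemma mpD v c d f : mp v c (mp v d f) = mp v (c + d) f.
Proof.
rewrite -[LHS]/((mp v c \o mp v d) f).
apply: morph_ext_mon => [a|m] /=; rewrite ?mp_const // !mp_mon.
rewrite rmorphM mp_mon fmorphXz mp_hfac_id -mulrA -expfzDr //.
by congr (_ * _ ^ _); ring.
Qed.

Lemma mp0 v f : mp v 0 f = f.
Proof.
rewrite -[RHS]/(idfun f); apply: morph_ext_mon => [a|m] /=; rewrite ?mp_const //.
by rewrite mp_mon mul0r oppr0 expr0z mulr1.
Qed.

(** The factors for [v] and [vneg v] differ by a monomial, by [hfac_neg], and enter with opposite
    exponents; only a power of that monomial survives. *)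
Lemma mp_neg_mp_mon v c m : mp (vneg v) c (mp v c (mon m)) =
  mon (vadd m (vscale (- (c * vdot m v)) (omega_dual k v))).
Proof.
rewrite mp_mon rmorphM fmorphXz mp_mon mp_hfac.
have -> : omega k (vneg v) v = 0 by rewrite /omega /vneg /=; ring.
rewrite mulr0 oppr0 expr0z mulr1 -/(h v) (hfac_neg v) expfzMl monD // mon_exp -!mulrA.
congr (_ * _); rewrite mulrCA -expfzDr //.
rewrite (_ : _ + _ = 0) ?expr0z ?mulr1 //.
by rewrite /vdot /vneg /=; ring.
Qed.

Lemma laurent_mp_neg_mp v c f : L f -> L (mp (vneg v) c (mp v c f)).
Proof.
elim=> [|a m g ha _ _ IH]; first by rewrite !rmorph0; apply: lspan0.
rewrite !rmorphD !rmorphM !mp_const mp_neg_mp_mon.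
by apply: lspanD => //; apply: lspan_mon.
Qed.

(** Monomial changes of variables preserve Laurent polynomials, so conditions at [vneg v] become
    conditions at [v] with the opposite exponent. *)
Lemma laurent_mp_neg v c f : L (mp (vneg v) c f) <-> L (mp v (- c) f).
Proof.
split=> H.
  have := laurent_mp_neg_mp (vneg v) (- c) H; rewrite vnegK.
  by rewrite mpD addNr mp0.
by have := laurent_mp_neg_mp v c H; rewrite mpD subrr mp0.
Qed.

(** * The grading by the pairing with [u] *)

Local Notation hom u d := (lspan (fun m => vdot m u = d)).

Lemma hom_laurent u d f : hom u d f -> L f.
Proof. exact: lspan_sub. Qed.

Lemma mp_hom u c d f : hom u d f -> mp u c f = h u ^ (- (c * d)) * f.
Proof.
elim=> [|a m g ha hm _ IH]; first by rewrite rmorph0 mulr0.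
rewrite rmorphD rmorphM mp_const mp_mon IH hm; ring.
Qed.

(* Eigenvectors of [mp u 1] for the distinct eigenvalues [h u ^ (- d)] are
   independent, even though these eigenvalues are not constants. *)
Lemma eigen_indep u (r : seq int) (F : int -> K) : k != 0 -> u <> (0, 0) -> uniq r ->
  (forall d, mp u 1 (F d) = h u ^ (- d) * F d) ->
  \sum_(d <- r) F d = 0 -> forall d, d \in r -> F d = 0.
Proof.
move=> k0 u0; elim: r F => // d0 r IH F /= /andP[d0r ur] eigF.
rewrite big_cons => sF.
have F'0 d : d \in r -> F d = 0.
  move=> dr; apply/eqP.
  (* Apply [mp u 1] to the relation and subtract [h u ^ (- d0)] times it: the term of [d0]
     disappears, and the other terms remain eigenvectors because [h u] is fixed. *)
  have : (h u ^ (- d) - h u ^ (- d0)) * F d == 0.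
    rewrite (IH (fun d => (h u ^ (- d) - h u ^ (- d0)) * F d)) // => [e|].
      by rewrite rmorphM rmorphB !fmorphXz mp_hfac_id eigF mulrCA.
    have := congr1 (mp u 1) sF; rewrite rmorph0 rmorphD rmorph_sum eigF /=.
    under eq_bigr do rewrite eigF.
    have SE : \sum_(d <- r) F d = - F d0 by apply/eqP; rewrite -addr_eq0 addrC sF.
    move=> E; under eq_bigr do rewrite mulrBl.
    by rewrite sumrB -mulr_sumr SE mulrN opprK addrC.
  rewrite mulf_eq0 => /orP[|//]; rewrite subr_eq0 => /eqP E.
  have := @hfac_not_unity _ _ _ mon_const k u (d - d0) k0 u0.
  rewrite subr_eq0 (contraNneq _ d0r) => [|<-//] /(_ isT).
  by rewrite -(inj_eq (mulfI (expfz_neq0 (- d) (h_neq0 u)))) -expfzDr // addKr mulr1 E eqxx.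
move=> d; rewrite inE => /orP[/eqP ->|/F'0 //].
by move: sF; rewrite big_seq big1 ?addr0 // => e /F'0.
Qed.

(** The sum is asserted over every larger duplicate-free list, so that two decompositions can be
    compared over a common index list. *)
Lemma hom_decomp u f : L f -> exists (r0 : seq int) (F : int -> K),
  (forall d, hom u d (F d)) /\
  (forall r, uniq r -> {subset r0 <= r} -> f = \sum_(d <- r) F d).
Proof.
elim=> [|c m g hc _ _ [r0 [F [hF sF]]]].
  exists [::], (fun=> 0); split=> [d|r _ _]; first exact: lspan0.
  by rewrite big1_eq.
exists (vdot m u :: r0), (fun d => (if d == vdot m u then C c * mon m else 0) + F d).
split=> [d|r ur sr].
  apply: lspanD => //; case: eqP => [->|_]; last exact: lspan0.
  exact: lspan_mon.
rewrite big_split /= -sF // => [|d dr]; last by rewrite sr // inE dr orbT.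
congr (_ + _); rewrite (bigD1_seq (vdot m u)) ?sr ?mem_head //= eqxx big1 ?addr0 //.
by move=> d /negPf ->.
Qed.

(** By independence of eigenvectors, the degree [d] piece of [mp u c f] is the twisted degree [d]
    piece of [f]. Thus both Laurent conditions descend to each piece separately. *)
Lemma hom_ind u c (P : K -> Prop) : k != 0 -> u <> (0, 0) ->
  P 0 -> (forall f g, P f -> P g -> P (f + g)) ->
  (forall d f, hom u d f -> hom u d (h u ^ (- (c * d)) * f) -> P f) ->
  forall f, L f -> L (mp u c f) -> P f.
Proof.
move=> k0 u0 P0 PD Phom f hf hg.
have [r [F [homF sumF]]] := hom_decomp u hf.
have [s [G [homG sumG]]] := hom_decomp u hg.
rewrite (sumF (undup r)) ?undup_uniq // => [|d]; last by rewrite mem_undup.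
apply: big_ind => // d _; apply: Phom (homF d) _.
suff -> : h u ^ (- (c * d)) * F d = G d by [].
pose t := undup (d :: r ++ s).
have sub_t e : [|| e == d, e \in r | e \in s] -> e \in t.
  by rewrite mem_undup inE mem_cat.
apply/eqP; rewrite -subr_eq0; apply/eqP.
apply: (@eigen_indep u t (fun d => h u ^ (- (c * d)) * F d - G d)) => //.
- exact: undup_uniq.
- move=> e; rewrite rmorphB rmorphM fmorphXz mp_hfac_id.
  by rewrite (mp_hom _ (homF e)) (mp_hom _ (homG e)) !mul1r mulrBr mulrCA.
- rewrite big_split sumrN /= -sumG ?undup_uniq // => [|e es]; last by rewrite sub_t ?es ?orbT.
  rewrite {1}(sumF t) ?undup_uniq // => [|e er]; last by rewrite sub_t ?er ?orbT.
  by rewrite rmorph_sum -sumrB big1 // => e _; rewrite (mp_hom _ (homF e)) subrr.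
- by rewrite sub_t ?eqxx.
Qed.

(** On a piece of degree [d] the twist multiplies by a power of [h v] that is monotone in the
    parameter. For [d <= 0] the condition at [c] follows from the one at [a], otherwise from the one
    at [b]. *)
Lemma laurent_mp_convex v a b c f : k != 0 -> v <> (0, 0) -> a <= c <= b ->
  L (mp v a f) -> L (mp v b f) -> L (mp v c f).
Proof.
move=> k0 v0 /andP[ac cb] ha hb.
have -> : mp v c f = mp v (c - a) (mp v a f) by rewrite mpD subrK.
have {}hb : L (mp v (b - a) (mp v a f)) by rewrite mpD subrK.
move: ha hb; apply: (@hom_ind v _ (fun g => L (mp v (c - a) g))) => //.
- by rewrite rmorph0; apply: lspan0.
- by move=> g g' hg hg'; rewrite rmorphD; apply: lspanD.
move=> d g hg hg'; rewrite (mp_hom _ hg); have [d0|d0] := leP d 0.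
  apply: laurentM; last exact: hom_laurent hg.
  by apply: laurentXz (laurent_hfac _ _); nia.
have -> : h v ^ (- ((c - a) * d)) = h v ^ ((b - c) * d) * h v ^ (- ((b - a) * d)).
  by rewrite -expfzDr //; congr (_ ^ _); ring.
rewrite -mulrA; apply: laurentM; last exact: hom_laurent hg'.
by apply: laurentXz (laurent_hfac _ _); nia.
Qed.

(** * Comparing the condition at [u] before and after a twist along [v] *)

Section KeyHalf.
Variables (u v : vec) (n : nat).
Hypotheses (k0 : k != 0) (n0 : (0 < n)%N) (uv0 : 0 < omega k u v).
Local Notation ne := (n%:Z * omega k u v).
Local Notation q := (1 + mon (omega_dual k v) * h u ^ ne).

Let ne_gt0 : 0 < ne. Proof. by rewrite mulr_gt0. Qed.
Let u0 : u <> (0, 0). Proof. by move=> E; move: uv0; rewrite E /omega /=; lia. Qed.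

(** As [ne] is positive, the remaining exponent is nonnegative; hence [q - 1] is a Laurent multiple
    of [h u]. *)
Let hu_pred : h u ^ ne = h u ^ (ne - 1) * h u.
Proof. by rewrite -[X in _ = _ * X]expr1z -expfzDr // subrK. Qed.

Let mp_hv : mp u (- n%:Z) (h v) = q.
Proof. by rewrite mp_hfac mulNr opprK. Qed.

Let laurent_q : L q.
Proof.
apply: lspanD; first exact: laurent1.
by apply: laurentM; [exact: laurent_mon | apply: laurentXz (laurent_hfac _ _); apply: ltW].
Qed.

Let q_neq0 : q != 0.
Proof. by rewrite -mp_hv fmorph_eq0. Qed.

Lemma laurent_clear_hfac f : L f -> exists N : nat, L (h u ^+ N * mp u (- n%:Z) f).
Proof.
elim=> [|c m g hc _ _ [N IH]]; first by exists 0%N; rewrite rmorph0 mulr0; apply: lspan0.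
exists (N + absz (n%:Z * vdot m u)%R)%N; rewrite rmorphD mulrDr; apply: lspanD; last first.
  by rewrite addnC exprD -mulrA; apply: laurentM => //; apply/laurentX/laurent_hfac.
rewrite rmorphM mp_const mp_mon mulrCA [mon m * _]mulrC (mulrA (_ ^+ _)); apply: laurentM.
  exact: laurent_const.
apply: laurentM; last exact: laurent_mon.
by rewrite exprnP -expfzDr //; apply: laurentXz (laurent_hfac _ _); lia.
Qed.

(* Since [q = 1] modulo [h u], it is comaximal with every power of [h u]. *)
Lemma laurent_cancel_q N f :
  L f -> L (q ^+ N * mp u (- n%:Z) f) -> L (mp u (- n%:Z) f).
Proof.
move=> /laurent_clear_hfac [M]; set g := mp u _ f => hM.
elim: N => [|N IH]; first by rewrite mul1r.
rewrite exprS -mulrA => hqN; apply: IH; move: hqN.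
have : L (h u ^+ M * (q ^+ N * g)).
  by rewrite mulrCA; apply: laurentM hM; apply: laurentX.
move: (q ^+ N * g) => g' {}hM hq.
have laurent_r : L (1 - q) by apply: lspanD (laurent1) _; apply: laurentN.
(* Each factor [1 - q] supplies one [h u], and [M] of them clear the denominator of [g']. *)
have : L ((1 - q) ^+ M * g').
  have -> : 1 - q = - mon (omega_dual k v) * h u ^ (ne - 1) * h u.
    by rewrite -mulrA -hu_pred; ring.
  rewrite exprMn -mulrA; apply: laurentM hM; apply: laurentX; apply: laurentM.
    exact/laurentN/laurent_mon.
  by apply: laurentXz (laurent_hfac _ _); move: ne_gt0; lia.
elim: M {hM} => [|M IH]; first by rewrite mul1r.
move=> hM; apply: IH.
(* Since [q * g'] is Laurent, the exponent of [1 - q] can be lowered one step at a time down to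
   0. *)
have -> : (1 - q) ^+ M * g' = (1 - q) ^+ M * (q * g') + (1 - q) ^+ M.+1 * g'.
  by rewrite exprS; ring.
by apply: lspanD => //; apply: laurentM => //; apply: laurentX.
Qed.

Let q_pow_sub1 (j : nat) : exists2 p, L p & q ^+ j - 1 = h u * p.
Proof.
exists (mon (omega_dual k v) * h u ^ (ne - 1) * \sum_(i < j) q ^+ i).
  apply: laurentM; first apply: laurentM.
  - exact: laurent_mon.
  - by apply: laurentXz (laurent_hfac _ _); move: ne_gt0; lia.
  - by apply: big_ind => [|f g|i _]; [exact: lspan0 | exact: lspanD | exact: laurentX].
rewrite subrX1 mulrA; congr (_ * _).
by rewrite hu_pred; ring.
Qed.

Let mp_mp_hu s : mp u (- n%:Z) (mp v s (h u)) =
  1 + mon (omega_dual k u) * q ^ (s * omega k u v).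
Proof.
rewrite mp_hfac rmorphD rmorph1 rmorphM fmorphXz mp_hv mp_mon.
rewrite vdot_omega_dual omegavv mulr0 oppr0 expr0z mulr1.
by congr (_ + _ * _ ^ _); rewrite omegaC mulrN opprK.
Qed.

(** The image of [h u] arises from [h u] by inserting a power of [q] before its monomial. Modulo
    [h u] that power is 1, so [h u] still divides the image once negative powers of [q] are
    cleared. *)
Let mp_mp_hu_dvd s : exists (N : nat) p,
  L p /\ q ^+ N * mp u (- n%:Z) (mp v s (h u)) = h u * p.
Proof.
rewrite mp_mp_hu; case: (s * _) => j.
  have [p hp E] := q_pow_sub1 j; exists 0%N, (1 + mon (omega_dual k u) * p); split.
    by apply: lspanD; [exact: laurent1 | apply: laurentM => //; exact: laurent_mon].
  by rewrite [RHS]mulrDr mulr1 [h u * (_ * _)]mulrCA -E /hfac -exprnP; ring.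
have [p hp E] := q_pow_sub1 j.+1; exists j.+1, (1 + p); split.
  by apply: lspanD => //; exact: laurent1.
have gen (Q w r : K) : Q != 0 -> Q - 1 = (1 + w) * r ->
    Q * (1 + w * Q^-1) = (1 + w) * (1 + r).
  by move=> Q0 Er; rewrite [RHS]mulrDr -Er; field.
by rewrite NegzE -exprnN; apply: gen => //; apply: expf_neq0.
Qed.

(** By [laurent_cancel_q] a power of [q] may be cleared first, and this weaker claim can be checked
    on the pieces for [u]. In degree [d >= 0] only nonnegative powers of [h u] appear; in negative
    degree divisibility by [h u] is carried along by [mp_mp_hu_dvd]. *)
Lemma laurent_mp_half s f : L f -> L (mp v s f) -> L (mp u (- n%:Z) f) ->
  L (mp u (- n%:Z) (mp v s f)).
Proof.
move=> hf hvf huf; suff [N hN] : exists N : nat, L (q ^+ N * mp u (- n%:Z) (mp v s f)).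
  exact: laurent_cancel_q hN.
have mp_mp_mon m : mp u (- n%:Z) (mp v s (mon m)) =
    mon m * h u ^ (n%:Z * vdot m u) * q ^ (- (s * vdot m v)).
  by rewrite mp_mon rmorphM fmorphXz mp_hv mp_mon mulNr opprK.
have q_clear m : L (q ^+ absz (s * vdot m v) * q ^ (- (s * vdot m v))).
  by rewrite exprnP -expfzDr //; apply: laurentXz => //; lia.
move: hf huf; pose P f := exists N : nat, L (q ^+ N * mp u (- n%:Z) (mp v s f)).
have P0 : P 0 by exists 0%N; rewrite !rmorph0 mulr0; apply: lspan0.
have PD f1 f2 : P f1 -> P f2 -> P (f1 + f2).
  move=> [N1 h1] [N2 h2]; exists (N1 + N2)%N; rewrite !rmorphD mulrDr.
  apply: lspanD; last by rewrite exprD -mulrA; apply: laurentM => //; apply: laurentX.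
  by rewrite addnC exprD -mulrA; apply: laurentM => //; apply: laurentX.
apply: (@hom_ind u _ P) => // d y hy hy'; have [d0|d0] := leP 0 d.
  elim: hy => [|c m g hc md _ IH]; first exact: P0.
  apply: PD => //; exists (absz (s * vdot m v)).
  rewrite !rmorphM !mp_const mp_mp_mon md mulrCA [_ * q ^ _]mulrC (mulrA (_ ^+ _)).
  apply: laurentM; first exact: laurent_const.
  apply: laurentM => //; apply: laurentM; first exact: laurent_mon.
  by apply: laurentXz (laurent_hfac _ _); rewrite mulr_ge0.
have [j jE] : exists j : nat, j%:Z = - (n%:Z * d) by exists (absz (n%:Z * d)); nia.
have -> : y = h u ^+ j * (h u ^ (- (- n%:Z * d)) * y).
  by rewrite exprnP jE mulrA -expfzDr // mulNr opprK addNr expr0z mul1r.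
elim: hy' => [|c m g hc md _ IH]; first by rewrite mulr0.
rewrite mulrDr; apply: PD => //.
have [N [p [hp Ep]]] := mp_mp_hu_dvd s.
(* The first summand clears [q] from the [j] images of [h u], the second from the image of the
   monomial. *)
exists (N * j + absz (s * vdot m v)%R)%N.
rewrite !rmorphM !rmorphXn !mp_const mp_mp_mon md exprD exprM.
set A := mp u _ (mp v s (h u)) in Ep *.
have -> : forall Q B c m H Q', Q ^+ j * B * (A ^+ j * (c * (m * H * Q'))) =
    c * m * (B * Q') * ((Q * A) ^+ j * H) :> K.
  by move=> *; rewrite exprMn; ring.
rewrite Ep.
have -> : (h u * p) ^+ j * h u ^ (n%:Z * d) = p ^+ j.
  by rewrite exprMn mulrAC (exprnP (h u)) jE -expfzDr // addNr expr0z mul1r.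
apply: laurentM; last exact: laurentX.
by apply: laurentM => //; apply: laurentM; [exact: laurent_const | exact: laurent_mon].
Qed.
End KeyHalf.

Lemma laurent_mp_pos u v (n : nat) f : k != 0 -> 0 < omega k u v -> L f -> L (mp v 1 f) ->
  L (mp u (- n%:Z) (mp v 1 f)) <-> L (mp u (- n%:Z) f).
Proof.
move=> k0 uv0 hf hvf; case: n => [|n]; first by rewrite !oppr0 !mp0.
split=> H; last exact: laurent_mp_half.
(* The converse is the same half with [s = -1], started from [mp v 1 f]. *)
have := @laurent_mp_half u v n.+1 k0 isT uv0 (-1) _ hvf.
by rewrite mpD addNr mp0; apply.
Qed.

(** The composite along [v] and [vneg v] is linear on exponents. Its transpose sends [u] to
    [pltrans k v u], and it carries the dual vector of [pltrans k v u] to that of [u]. *)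
Lemma mp_neg_mp_pltrans u v c f : 0 < omega k v u ->
  mp (vneg v) 1 (mp v 1 (mp (pltrans k v u) c f)) = mp u c (mp (vneg v) 1 (mp v 1 f)).
Proof.
move=> vu0; rewrite -[LHS]/((mp (vneg v) 1 \o mp v 1 \o mp (pltrans k v u) c) f).
rewrite -[RHS]/((mp u c \o (mp (vneg v) 1 \o mp v 1)) f).
apply: morph_ext_mon => [a|m] /=; first by rewrite !mp_const.
rewrite mp_neg_mp_mon (mp_mon (pltrans k v u)) (mp_mon u) !rmorphM !fmorphXz /hfac.
rewrite !rmorphD !rmorph1 !mp_neg_mp_mon /pltrans.
rewrite max_r ?(ltW vu0) //; congr (_ * (1 + mon _) ^ _).
  by apply: vec_eqP; rewrite /vdot /omega_dual /omega /vadd /vscale /=; ring.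
by rewrite /vdot /omega_dual /omega /vadd /vscale /=; ring.
Qed.

Lemma laurent_mp_pltrans u v (n : nat) f :
  k != 0 -> omega k v u != 0 -> L f -> L (mp v 1 f) ->
  L (mp u (- n%:Z) (mp v 1 f)) <-> L (mp (pltrans k v u) (- n%:Z) f).
Proof.
move=> k0 vu0 hf hvf; have [vu_gt0|vu_le0] := ltP 0 (omega k v u); last first.
  have uv_gt0 : 0 < omega k u v by rewrite omegaC oppr_gt0 lt_neqAle vu0.
  have -> : pltrans k v u = u.
    by rewrite /pltrans max_l //; apply: vec_eqP; rewrite /vadd /vscale /=; ring.
  exact: laurent_mp_pos.
have uv_gt0 : 0 < omega k u (vneg v).
  by move: vu_gt0; rewrite /omega /vneg /=; congr (_ < _); ring.
(* The positive case is applied in direction [vneg v] with [mp v 1 f] as the starting element;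
   conjugation then turns the condition at [u] into one at [pltrans k v u]. *)
have hT : L (mp (vneg v) 1 (mp v 1 f)) by apply: laurent_mp_neg_mp.
rewrite -(@laurent_mp_pos u (vneg v) n _ k0 uv_gt0 hvf hT) -mp_neg_mp_pltrans //.
split=> H; last exact: laurent_mp_neg_mp.
by have := laurent_mp_neg_mp (vneg v) (-1) H; rewrite vnegK mpD addNr mp0 mpD addNr mp0.
Qed.

(** * Upper bounds and their invariance under one mutation *)

Definition uspan V f := L f /\ forall u, L (mp u (- (count_mem u V)%:Z) f).

Lemma uspan_mutate V i f : k != 0 -> (forall v, v \in V -> primitive v) -> (i < size V)%N ->
  uspan V (mp (nth (0, 0) V i) 1 f) <-> uspan (mutate k V i) f.
Proof.
move=> k0 VP iV; set v := nth _ V i.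
have vP : primitive v by apply/VP/mem_nth.
have v0 : v <> (0, 0) by case: vP.
have cv := count_mutate_dir k iV vP; have cv' := count_mutate_neg k iV vP.
rewrite -/v in cv cv'.
have atv : L (mp v (- (count_mem v V)%:Z) (mp v 1 f)) <->
           L (mp v (- (count_mem v (mutate k V i))%:Z) f).
  by rewrite mpD cv intS opprD addrAC addNr add0r.
have atv' : L (mp (vneg v) (- (count_mem (vneg v) V)%:Z) (mp v 1 f)) <->
            L (mp (vneg v) (- (count_mem (vneg v) (mutate k V i))%:Z) f).
  by rewrite !laurent_mp_neg mpD cv' !opprK intS addrC.
have other u : u != v -> u != vneg v -> L f -> L (mp v 1 f) ->
    L (mp u (- (count_mem u V)%:Z) (mp v 1 f)) <->
    L (mp (pltrans k v u) (- (count_mem (pltrans k v u) (mutate k V i))%:Z) f).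
  move=> uv uv' hf hvf; rewrite count_mutate // -/v.
  (* Multiplicity 0 leaves only the assumed conditions. Otherwise [u] occurs in [V], hence is
     primitive and not parallel to [v]. *)
  have [->|c0] := posnP (count_mem u V); first by rewrite oppr0 !mp0.
  apply: laurent_mp_pltrans => //; apply/eqP => /(primitive_parallel k0).
  have uP : primitive u by apply: VP; rewrite -has_pred1 has_count.
  by case/(_ uP vP) => /eqP; apply/negP.
split=> [[hvf hV]|[hf hV]].
- have hf : L f.
    (* As [v] occurs in [V], -1 lies between minus its multiplicity and 0, so convexity applies to
       [mp v 1 f]. *)
    rewrite -[f](mp0 v) -(addNr 1) -mpD.
    apply: (@laurent_mp_convex v (- (count_mem v V)%:Z) 0) => //; last by rewrite mp0.
    by rewrite cv; lia.
  split=> // u.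
  have [->|uv] := eqVneq u v; first by rewrite -atv.
  have [->|uv'] := eqVneq u (vneg v); first by rewrite -atv'.
  rewrite -[u](pltrans_invK k v) -other //.
    by apply: contraNneq uv => E; rewrite -[u](pltrans_invK k v) E pltrans_id.
  by apply: contraNneq uv' => E; rewrite -[u](pltrans_invK k v) E pltrans_neg.
- have hvf : L (mp v 1 f).
    (* The mutated collection contains [vneg v]; its condition bounds the parameter 1 from above,
       and [L f] bounds it from below. *)
    have := hV (vneg v); rewrite cv' laurent_mp_neg opprK => hv'.
    by apply: (@laurent_mp_convex v 0 _ 1 f k0 v0 _ _ hv'); [rewrite ler01 | rewrite mp0].
  split=> // u.
  have [->|uv] := eqVneq u v; first by rewrite atv.
  have [->|uv'] := eqVneq u (vneg v); first by rewrite atv'.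
  by rewrite other.
Qed.

Variables (laur : K -> Prop) (mu : vec -> K -> K).
Hypothesis laurP : forall f, laur f <-> L f.
Hypothesis mu_mp : forall v f, mu v f = mp v 1 f.

(** The abstract form of [upper], which is recovered by substituting [laurent] and [mu]. *)
Definition upper_bound V f :=
  laur f /\ forall v, exists g, laur g /\ iter (count_mem v V) (mu v) g = f.

Lemma upper_boundE V f : upper_bound V f <-> uspan V f.
Proof.
have iter_mu v n g : iter n (mu v) g = mp v n%:Z g.
  by elim: n => [|n IH] /=; rewrite ?mp0 // mu_mp IH mpD -intS.
split=> -[/laurP hf hV]; split=> //; try exact/laurP.
- move=> u; have [g [/laurP hg <-]] := hV u.
  by rewrite iter_mu mpD addNr mp0.
- move=> u; exists (mp u (- (count_mem u V)%:Z) f); rewrite iter_mu mpD subrr mp0.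
  by split=> //; apply/laurP.
Qed.

Lemma upper_bound_mutate V i f : k != 0 -> (forall v, v \in V -> primitive v) ->
  (i < size V)%N ->
  upper_bound V f <->
  exists g, upper_bound (mutate k V i) g /\ f = mu (nth (0, 0) V i) g.
Proof.
move=> k0 VP iV; have mutP := @uspan_mutate V i _ k0 VP iV; set v := nth _ V i in mutP *.
split=> [|[g [/upper_boundE /mutP hg ->]]]; last by rewrite upper_boundE mu_mp.
rewrite upper_boundE => hf; exists (mp v (-1) f); rewrite upper_boundE -mutP.
by rewrite mu_mp mpD subrr mp0.
Qed.
End LaurentSpan.

(** * Spans of monomials versus polynomials over a monomial denominator *)

Section LaurentPoly.
Variables (K : fieldType) (phi : {rmorphism Pol -> K}).
Local Notation y1 := (phi ('X : {poly algC})%:P).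
Local Notation y2 := (phi 'X).
Local Notation C := (phi \o (@polyC {poly algC} \o @polyC algC)).
Hypotheses (y1_neq0 : y1 != 0) (y2_neq0 : y2 != 0).
Local Notation L := (lspan (lmon y1 y2) C (fun=> True)).

Let lmonD' := lmonD y1_neq0 y2_neq0.

Let laurent_y1 (i : nat) : L (y1 ^ i%:Z).
Proof.
have := @laurent_mon K (lmon y1 y2) C (i%:Z, 0).
by rewrite /lmon /= expr0z mulr1.
Qed.

Let laurent_y2 (i : nat) : L (y2 ^ i%:Z).
Proof.
have := @laurent_mon K (lmon y1 y2) C (0, i%:Z).
by rewrite /lmon /= expr0z mul1r.
Qed.

Lemma lspan_Pol (p : Pol) : (forall i j, inQab (p`_i)`_j) -> L (phi p).
Proof.
move=> hp; rewrite -[p]coefK poly_def rmorph_sum.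
apply: big_ind => [|f g|i _]; [exact: lspan0 | exact: lspanD |].
rewrite -mul_polyC rmorphM rmorphXn; apply: (laurentM lmonD' _ (laurent_y2 i)).
rewrite -[p`_i]coefK poly_def !rmorph_sum.
apply: big_ind => [|f g|j _]; [exact: lspan0 | exact: lspanD |].
rewrite -mul_polyC !rmorphM !rmorphXn; apply: (laurentM lmonD' _ (laurent_y1 j)).
by apply: (@laurent_const K (lmon y1 y2) C (lmon0 _ _)).
Qed.

Lemma lspan_PolP f : L f <-> exists (p : Pol) (a b : nat),
  (forall i j, inQab (p`_i)`_j) /\ f = phi p * (y1 ^- a * y2 ^- b).
Proof.
split=> [|[p [a [b [hp ->]]]]]; last first.
  apply: laurentM => //; first exact: lspan_Pol.
  have := @laurent_mon K (lmon y1 y2) C (- a%:Z, - b%:Z).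
  by rewrite /lmon /= -!exprnN.
elim=> [|c m g hc _ _ [p [a [b [hp ->]]]]].
  exists 0, 0%N, 0%N; rewrite rmorph0 mul0r; split=> // i j.
  by rewrite !coef0; exact: inQab0.
case: m => m1 m2; have [i [i' ->]] := int_nat_sub m1; have [j [j' ->]] := int_nat_sub m2.
(* The new term and the previous fraction are brought to the product of their monomial
   denominators. *)
exists ((c%:P * 'X^(i + a))%:P * 'X^(j + b) + p * ('X^i')%:P * 'X^j'), (i' + a)%N, (j' + b)%N.
split=> [n l|].
  rewrite !coefD; apply: inQabD.
    rewrite coefMXn; case: ifP => _; first by rewrite coef0; exact: inQab0.
    rewrite coefC; case: ifP => _; last by rewrite coef0; exact: inQab0.
    rewrite coefCM coefXn; case: eqP => _; rewrite ?mulr1 ?mulr0 //; exact: inQab0.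
  rewrite coefMXn; case: ifP => _; first by rewrite coef0; exact: inQab0.
  rewrite coefMC coefMXn; case: ifP => _; first exact: inQab0.
  exact: hp.
rewrite !rmorphD !rmorphM !rmorphXn /lmon /= !expfzDr // -!exprnN -!exprnP !exprD.
by field; rewrite !expf_neq0.
Qed.
End LaurentPoly.

(** * Instantiation in the field of rational functions and the theorem *)

Local Notation polyCC := (@polyC {poly algC} \o @polyC algC).

Lemma PolX1_neq0 : ('X : {poly algC})%:P != 0 :> Pol.
Proof. by rewrite polyC_eq0 polyX_eq0. Qed.

Lemma PolX2_neq0 : 'X != 0 :> Pol.
Proof. by rewrite polyX_eq0. Qed.

(** Comparison of the coefficients at [(i, j)]: the left one is 1, the right one vanishes unless the
    exponents agree. *)
Lemma Pol_mon_indep (c : algC) i j i' j' :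
  ('X : {poly algC})%:P ^+ i * 'X ^+ j = polyCC c * (('X : {poly algC})%:P ^+ i' * 'X ^+ j') ->
  i = i' /\ j = j'.
Proof.
move=> E; have := congr1 (fun p : Pol => (p`_j)`_i) E.
rewrite /= -!polyC_exp !coefCM !coefXn eqxx mulr1 coefXn eqxx.
case: eqP => [->|_]; last by rewrite mulr0 coef0 mulr0 => /eqP; rewrite oner_eq0.
rewrite mulr1 coefXn; case: eqP => [->//|_].
by rewrite mulr0 => /eqP; rewrite oner_eq0.
Qed.

Definition evm (a b : KL) : {rmorphism Pol -> KL} := ev a b.

Definition mupow k v : int -> KL -> KL :=
  @twist _ ('X : {poly algC})%:P 'X evm k v.

Lemma mupow_is_zmod_morphism k v c : zmod_morphism (mupow k v c).
Proof.
exact: (@twist_is_zmod_morphism _ polyCC _ _ evm ev_const ev_X1 ev_X2 Pol_ind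
  PolX1_neq0 PolX2_neq0 Pol_mon_indep).
Qed.

Lemma mupow_is_monoid_morphism k v c : monoid_morphism (mupow k v c).
Proof.
exact: (@twist_is_monoid_morphism _ polyCC _ _ evm ev_const ev_X1 ev_X2 Pol_ind
  PolX1_neq0 PolX2_neq0 Pol_mon_indep).
Qed.

HB.instance Definition _ k v c :=
  GRing.isZmodMorphism.Build KL KL (mupow k v c) (mupow_is_zmod_morphism k v c).
HB.instance Definition _ k v c :=
  GRing.isMonoidMorphism.Build KL KL (mupow k v c) (mupow_is_monoid_morphism k v c).
Definition mupowm k v c : {rmorphism KL -> KL} := mupow k v c.

Local Notation cstm := (@tofrac Pol \o polyCC).

Lemma mupow_const k v c a : mupowm k v c (cstm a) = cstm a.
Proof.
exact: (@twist_const _ polyCC _ _ evm ev_const ev_X1 ev_X2 Pol_ind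
  PolX1_neq0 PolX2_neq0 Pol_mon_indep).
Qed.

Lemma mupow_mon k v c m :
  mupowm k v c (lmon x1 x2 m) = lmon x1 x2 m * hfac (lmon x1 x2) k v ^ (- (c * vdot m v)).
Proof.
exact: (@twist_mon _ polyCC _ _ evm ev_const ev_X1 ev_X2 Pol_ind
  PolX1_neq0 PolX2_neq0 Pol_mon_indep).
Qed.

Lemma mu_mupow k v f : mu k v f = mupowm k v 1 f.
Proof.
change (frac_ext (evm (x1 * hfac (lmon x1 x2) k v ^ (- v.1))
                      (x2 * hfac (lmon x1 x2) k v ^ (- v.2))) f =
        frac_ext (evm (x1 * hfac (lmon x1 x2) k v ^ (- (1 * v.1)))
                      (x2 * hfac (lmon x1 x2) k v ^ (- (1 * v.2)))) f).
by rewrite (mul1r v.1) (mul1r v.2).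
Qed.

Lemma KL_ext (f g : {rmorphism KL -> KL}) :
  (forall c, f (cstm c) = g (cstm c)) ->
  (forall m, f (lmon x1 x2 m) = g (lmon x1 x2 m)) -> f =1 g.
Proof.
move=> fc fm; apply: (@frac_morphism_ext _ polyCC _ _ Pol_ind) => //.
  have := fm (1, 0); rewrite /lmon [_ ^ _]expr1z [X in _ * X]expr0z mulr1; exact.
have := fm (0, 1); rewrite /lmon [X in X * _]expr0z [_ ^ _]expr1z mul1r; exact.
Qed.

Lemma upper_mutate k V i f : k != 0 -> (forall v, v \in V -> primitive v) ->
  (i < size V)%N ->
  upper k V f <-> exists g, upper k (mutate k V i) g /\ f = mu k (nth (0, 0) V i) g.
Proof.
have x1_neq0 : x1 != 0 by exact: (tofracX1_neq0 PolX1_neq0).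
have x2_neq0 : x2 != 0 by exact: (tofracX2_neq0 PolX2_neq0).
have laurP g : laurent g <-> lspan (lmon x1 x2) cstm (fun=> True) g.
  by apply: iff_sym; exact: (@lspan_PolP _ (@tofrac Pol) x1_neq0 x2_neq0).
exact: (@upper_bound_mutate _ _ cstm (lmon0 x1 x2) (lmonD x1_neq0 x2_neq0)
  (lmon_exp x1 x2) (lmon_const PolX1_neq0 PolX2_neq0 Pol_mon_indep) k (mupowm k)
  (mupow_const k) (mupow_mon k) KL_ext laurent (mu k) laurP (mu_mupow k)).
Qed.

Theorem theorem3p1 (k : int) (V : seq vec) :
  k != 0 ->
  (forall v, v \in V -> primitive v) ->
  (forall i : nat, (i < size V)%N ->
     forall f : KL, upper k V f <->
       exists g, upper k (mutate k V i) g /\ f = mu k (nth (0, 0) V i) g)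
  /\
  (forall s : seq nat, all (fun i => (i < size V)%N) s ->
     forall f : KL, upper k V f <->
       exists g, upper k (foldl (mutate k) V s) g /\ f = mu_seq k V s g).
Proof.
move=> k0 VP; split=> [i iV f|s]; first exact: upper_mutate.
elim: s V VP => [|i s IH] V VP /=; first by move=> _ f; split=> [hf|[g [hg ->]]] //; exists f.
move=> /andP[iV sV] f; rewrite (upper_mutate f k0 VP iV).
have {}IH := IH (mutate k V i) (primitive_mutate iV VP).
rewrite (size_mutate k V i) in IH; have {}IH := IH sV.
split=> [[g [/IH [g' [hg' ->]] ->]]|[g [hg ->]]]; first by exists g'.
by exists (mu_seq k (mutate k V i) s g); split=> //; apply/IH; exists g.
Qed.
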